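(* The following four mesh patterns $(12,R)$ are pairwise equidistributed, where $R$ ranges over: $\{(0,2),(1,2),(2,2),(1,1),(2,1),(0,0),(2,0)\}$, $\{(0,2),(2,2),(0,1),(1,1),(0,0),(1,0),(2,0)\}$, $\{(0,2),(1,2),(2,2),(0,1),(2,1),(1,0),(2,0)\}$, $\{(0,2),(1,2),(0,1),(2,1),(0,0),(1,0),(2,0)\}$. Moreover, for each such pattern $p$, with $F(x)=\sum_{n\ge0}n!x^n$, $A(x)=\sum_{n\ge0}s_{n,0}(p)x^n$ and $F(x,q)=\sum_{n\ge0}x^n\sum_{\pi\in S_n}q^{p(\pi)}$, $$A(x)=(1-x)F(x)+\frac{xF(x)}{1+xF(x)},\qquad F(x,q)=(1-x)F(x)+\frac{xF(x)}{1+x(1-q)F(x)}.$$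
   Context: For $R\subseteq\{0,1,2\}^2$ and $\pi=\pi_1\cdots\pi_n\in S_n$, an occurrence of the mesh pattern $(12,R)$ in $\pi$ is a pair of positions $i_1<i_2$ with $\pi_{i_1}<\pi_{i_2}$ such that, setting $x_0=0,x_1=i_1,x_2=i_2,x_3=n+1$ and $y_0=0,y_1=\pi_{i_1},y_2=\pi_{i_2},y_3=n+1$, for every $(a,b)\in R$ there is no index $k$ with $x_a<k<x_{a+1}$ and $y_b<\pi_k<y_{b+1}$. $p(\pi)$ is the number of occurrences of $p$ in $\pi$; $s_{n,k}(p)$ the number of $\pi\in S_n$ with $p(\pi)=k$; $p_1,p_2$ are equidistributed if $s_{n,k}(p_1)=s_{n,k}(p_2)$ for all $n,k\ge 0$. Generating functions are formal power series. *)

(* Defs.v *)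
From HB Require Import structures.
From mathcomp Require Import all_boot all_order all_algebra all_fingroup.

Set Implicit Arguments.
Unset Strict Implicit.
Unset Printing Implicit Defensive.

Import GRing.Theory.

(* A permutation of {1, ..., n} is pi : 'S_n, a permutation of {0, ..., n-1}:
   position i and value pi i stand for i.+1 and (pi i).+1. *)

Section MeshPatterns.

Variable n : nat.
Implicit Types (R : {set 'I_3 * 'I_3}) (pi : 'S_n) (i j k : 'I_n).

Definition mesh_xs i j : seq nat := [:: 0; i.+1; j.+1; n.+1].
Definition mesh_ys pi i j : seq nat := [:: 0; (pi i).+1; (pi j).+1; n.+1].

Definition in_box pi i j (b : 'I_3 * 'I_3) k : bool :=
  (nth 0 (mesh_xs i j) b.1 < k.+1 < nth 0 (mesh_xs i j) b.1.+1) &&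
  (nth 0 (mesh_ys pi i j) b.2 < (pi k).+1 < nth 0 (mesh_ys pi i j) b.2.+1).

Definition mesh12_occ R pi i j : bool :=
  [&& i < j, pi i < pi j &
      [forall b in R, [forall k : 'I_n, ~~ in_box pi i j b k]]].

Definition mesh12_count R pi : nat :=
  #|[set ij : 'I_n * 'I_n | mesh12_occ R pi ij.1 ij.2]|.

End MeshPatterns.

Definition mesh12_s (n k : nat) (R : {set 'I_3 * 'I_3}) : nat :=
  #|[set pi : 'S_n | mesh12_count R pi == k]|.

Definition equidistributed (R1 R2 : {set 'I_3 * 'I_3}) : Prop :=
  forall n k : nat, mesh12_s n k R1 = mesh12_s n k R2.

Definition box (a b : nat) : 'I_3 * 'I_3 := (inord a, inord b).

Definition R1 : {set 'I_3 * 'I_3} :=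
  [set box 0 2; box 1 2; box 2 2; box 1 1; box 2 1; box 0 0; box 2 0].
Definition R2 : {set 'I_3 * 'I_3} :=
  [set box 0 2; box 2 2; box 0 1; box 1 1; box 0 0; box 1 0; box 2 0].
Definition R3 : {set 'I_3 * 'I_3} :=
  [set box 0 2; box 1 2; box 2 2; box 0 1; box 2 1; box 1 0; box 2 0].
Definition R4 : {set 'I_3 * 'I_3} :=
  [set box 0 2; box 1 2; box 0 1; box 2 1; box 0 0; box 1 0; box 2 0].

Definition four_patterns : seq {set 'I_3 * 'I_3} := [:: R1; R2; R3; R4].

Local Open Scope ring_scope.

(* Formal power series sum_n (f n) x^n, compared coefficientwise by =1. *)
Definition fps (K : Type) : Type := nat -> K.

Declare Scope fps_scope.
Delimit Scope fps_scope with fps.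
Bind Scope fps_scope with fps.

Section FormalPowerSeries.

Variable K : comUnitRingType.
Implicit Types f g : fps K.

Definition fps_const (c : K) : fps K := fun n => if n == 0%N then c else 0.
Definition fps_X : fps K := fun n => if n == 1%N then 1 else 0.
Definition fps_add f g : fps K := fun n => f n + g n.
Definition fps_sub f g : fps K := fun n => f n - g n.
Definition fps_mul f g : fps K := fun n => \sum_(i < n.+1) f i * g (n - i)%N.

(* The first n coefficients of 1 / f, obtained by solving f * g = 1. *)
Fixpoint fps_inv_coefs f (n : nat) : seq K :=
  if n is m.+1 then
    let s := fps_inv_coefs f m in
    rcons s ((f 0%N)^-1 * ((m == 0%N)%:R - \sum_(i < m) f (m - i)%N * s`_i))
  else [::].

(* Meaningful when f 0 is a unit, see fps_mulfV. *)
Definition fps_inv f : fps K := fun n => (fps_inv_coefs f n.+1)`_n.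

Definition fps_div f g : fps K := fps_mul f (fps_inv g).

Lemma size_fps_inv_coefs f n : size (fps_inv_coefs f n) = n.
Proof. by elim: n => //= n IHn; rewrite size_rcons IHn. Qed.

Lemma nth_fps_inv_coefs f n i :
  (i < n)%N -> (fps_inv_coefs f n)`_i = fps_inv f i.
Proof.
elim: n => // n IHn; rewrite ltnS leq_eqVlt => /predU1P[-> // | lt_in].
by rewrite /= nth_rcons size_fps_inv_coefs lt_in IHn.
Qed.

Lemma fps_mulfV f :
  f 0%N \is a GRing.unit -> fps_mul f (fps_inv f) =1 fps_const 1.
Proof.
move=> Uf n; rewrite /fps_mul (reindex_inj rev_ord_inj) big_ord_recr /=.
rewrite subSS subnn subn0 {2}/fps_inv /= nth_rcons size_fps_inv_coefs.
rewrite ltnn eqxx mulrA mulrV // mul1r.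
have -> : \sum_(i < n) f (n.+1 - (widen_ord (leqnSn n) i).+1)%N
            * fps_inv f (n - (n.+1 - (widen_ord (leqnSn n) i).+1))%N
        = \sum_(i < n) f (n - i)%N * (fps_inv_coefs f n)`_i.
  apply: eq_bigr => i _.
  by rewrite subSS /= subKn ?nth_fps_inv_coefs // ltnW.
by rewrite addrC subrK /fps_const; case: eqP.
Qed.

End FormalPowerSeries.

Arguments fps_X {K}.

Notation "1" := (fps_const 1%R) : fps_scope.
Notation "''x'" := fps_X : fps_scope.
Notation "f + g" := (fps_add f g) : fps_scope.
Notation "f - g" := (fps_sub f g) : fps_scope.
Notation "f * g" := (fps_mul f g) : fps_scope.
Notation "f / g" := (fps_div f g) : fps_scope.

Definition fact_series (K : comUnitRingType) : fps K := fun n => n`!%:R.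

Definition avoid_series (R : {set 'I_3 * 'I_3}) : fps int :=
  fun n => (mesh12_s n 0 R)%:R.

(* Coefficients in Z[q]; the polynomial variable 'X plays the role of q. *)
Definition distr_series (R : {set 'I_3 * 'I_3}) : fps {poly int} :=
  fun n => \sum_(pi : 'S_n) 'X ^+ mesh12_count R pi.

Definition fps_q : fps {poly int} := fps_const 'X.

(* Main.v *)
Require Import Defs.
From mathcomp Require Import all_boot all_order all_algebra all_fingroup.
From mathcomp Require Import zify.

(** For these patterns one of the two entries of an occurrence is forced: it is
    a maximum in last position ([R1], [R3]) or a minimum in first position
    ([R2], [R4]). Deleting it leaves a permutation [s] in which the other entry
    is a strong point, i.e. [s = a ⊕ 1 ⊕ b] ([R3], [R4]) or [s = a ⊖ 1 ⊖ b]
    ([R1], [R2]) around that entry; reversal exchanges the two kinds. So with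
    [D(x, q)] the distribution of the number [N] of strong points,
    [F(x, q) = (1 - x) F(x) + x D(x, q)].
    Telescoping, [q ^ N - 1] is the sum over the strong points [i] of
    [(q - 1) q ^ #(strong points before i)]. Splitting [s] at [i] as [a ⊕ 1 ⊕ b]
    and summing over [s] gives [D - F = (q - 1) x D F]. *)

Set Implicit Arguments.
Unset Strict Implicit.
Unset Printing Implicit Defensive.

Import GRing.Theory.

(** * Formal power series *)

Section FpsTheory.
Variable K : comUnitRingType.
Implicit Types f g h : fps K.
Local Open Scope ring_scope.

Lemma eq_fps_mul f f' g g' :
  f =1 f' -> g =1 g' -> (f * g)%fps =1 (f' * g')%fps.
Proof. by move=> ef eg n; apply: eq_bigr => i _; rewrite ef eg. Qed.

(** Cutting both factors down to polynomials keeps these coefficients, so associativity of the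
    product comes from that of polynomials. *)
Lemma fps_mul_coefM n f g i : (i <= n)%N ->
  (f * g)%fps i = (\poly_(j < n.+1) f j * \poly_(j < n.+1) g j)`_i.
Proof.
move=> le_in; rewrite coefM; apply: eq_bigr => j _.
rewrite !coef_poly !ltnS (leq_trans (leq_subr _ _) le_in).
by rewrite (leq_trans _ le_in) // -ltnS.
Qed.

Lemma fps_mulA f g h : (f * (g * h))%fps =1 (f * g * h)%fps.
Proof.
move=> n; rewrite !(@fps_mul_coefM n) // .
set F := \poly_(j < _) f j; set H := \poly_(j < _) h j.
pose G := \poly_(j < n.+1) g j.
transitivity ((F * (G * H))`_n).
  rewrite [LHS]coefM [RHS]coefM; apply: eq_bigr => i _; congr (_ * _).
  by rewrite coef_poly ltnS leq_subr (@fps_mul_coefM n) // leq_subr.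
rewrite mulrA [LHS]coefM [RHS]coefM; apply: eq_bigr => i _; congr (_ * _).
by rewrite coef_poly ltn_ord (@fps_mul_coefM n) // -ltnS.
Qed.

Lemma fps_mulr1 f : (f * 1)%fps =1 f.
Proof.
move=> n; rewrite /fps_mul big_ord_recr /= big1 ?add0r => [|i _].
  by rewrite subnn /fps_const eqxx mulr1.
by rewrite /fps_const subn_eq0 leqNgt ltn_ord mulr0.
Qed.

Lemma fps_mulX0 f : ('x * f)%fps 0 = 0.
Proof. by rewrite /fps_mul big_ord1 /fps_X mul0r. Qed.

Lemma fps_mulXS f n : ('x * f)%fps n.+1 = f n.
Proof.
rewrite /fps_mul big_ord_recl {1}/fps_X mul0r add0r big_ord_recl /fps_X /=.
by rewrite mul1r big1 ?addr0 ?subSS ?subn0 // => i _; rewrite mul0r.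
Qed.

Lemma fps_mulBl f g h n : ((f - g) * h)%fps n = (f * h)%fps n - (g * h)%fps n.
Proof. by rewrite /fps_mul -sumrB; apply: eq_bigr => i _; rewrite mulrBl. Qed.

Lemma fps_mulCl c f n : (fps_const c * f)%fps n = c * f n.
Proof.
rewrite /fps_mul big_ord_recl subn0 /fps_const eqxx big1 ?addr0 // => i _.
by rewrite mul0r.
Qed.

Lemma fps_mulK f g : g 0 \is a GRing.unit -> (f * g / g)%fps =1 f.
Proof.
move=> Ug n; rewrite /fps_div -fps_mulA -[RHS]fps_mulr1.
by apply: eq_fps_mul => // m; apply: fps_mulfV.
Qed.

End FpsTheory.

(** * Strong points *)

(* [c] tells the two kinds of point apart: for [c = true] the permutation is
   [a ⊕ 1 ⊕ b] with the summand [1] at [i], for [c = false] it is the skew sum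
   [a ⊖ 1 ⊖ b]. *)
Definition strong_point (c : bool) n (s : 'S_n) (i : 'I_n) : bool :=
  [forall k : 'I_n, (s k < s i) == (if c then k < i else i < k)].

(** The preimage under [s] of the values below [s i] is the set of positions below [i], and [s]
    preserves cardinalities. *)
Lemma strong_point_fixed n (s : 'S_n) i : strong_point true s i -> s i = i.
Proof.
move=> /forallP si; have card_lt (j : 'I_n) : #|[set k : 'I_n | k < j]| = j.
  have lejn : j <= n by apply/ltnW.
  have widen_inj : injective (widen_ord lejn).
    by move=> x y /(congr1 val) /= /val_inj.
  rewrite -[RHS]card_ord -(card_imset _ widen_inj).
  apply: eq_card => k; rewrite inE; apply/idP/imsetP => [ltkj | [k' _ ->]] //=.
  by exists (Ordinal ltkj) => //; apply: val_inj.
apply: val_inj; rewrite /= -[LHS]card_lt -[RHS]card_lt.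
rewrite -(card_preimset _ (@perm_inj _ s)); apply: eq_card => k.
by rewrite !inE (eqP (si k)).
Qed.

(** * Direct sums of permutations *)

Section BlockPerm.
Variables k m : nat.

Definition block_fun (ab : 'S_k * 'S_m) (i : 'I_(k + m)) : 'I_(k + m) :=
  match split i with
  | inl j => lshift m (ab.1 j)
  | inr j => rshift k (ab.2 j)
  end.

Lemma block_fun_inj ab : injective (block_fun ab).
Proof.
move=> i j; rewrite /block_fun.
case: (split_ordP i) => i' ->; case: (split_ordP j) => j' -> /eqP.
- by rewrite eq_lshift => /eqP/perm_inj ->.
- by rewrite eq_lrshift.
- by rewrite eq_rlshift.
- by rewrite eq_rshift => /eqP/perm_inj ->.
Qed.

Definition block_perm ab : 'S_(k + m) := perm (@block_fun_inj ab).

Lemma block_permL ab i : block_perm ab (lshift m i) = lshift m (ab.1 i).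
Proof. by rewrite permE /block_fun (unsplitK (inl i)). Qed.

Lemma block_permR ab i : block_perm ab (rshift k i) = rshift k (ab.2 i).
Proof. by rewrite permE /block_fun (unsplitK (inr i)). Qed.

Lemma block_perm_inj : injective block_perm.
Proof.
move=> [a b] [a' b'] /permP e; congr (_, _); apply/permP => i.
  by have := e (lshift m i); rewrite !block_permL => /eqP; rewrite eq_lshift => /eqP.
by have := e (rshift k i); rewrite !block_permR => /eqP; rewrite eq_rshift => /eqP.
Qed.

(** Stabilising the first [k] points, [s] also stabilises the last [m]; its two restrictions are the
    summands. *)
Lemma block_permP (s : 'S_(k + m)) :
  (forall i, (s i < k) = (i < k)) -> exists ab, s = block_perm ab.
Proof.
move=> sk.
have sL (i : 'I_k) : exists j : 'I_k, s (lshift m i) == lshift m j.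
  have lt_sk : s (lshift m i) < k by rewrite sk /= ltn_ord.
  by exists (Ordinal lt_sk); apply/eqP/val_inj.
have sR (i : 'I_m) : exists j : 'I_m, s (rshift k i) == rshift k j.
  have : ~~ (s (rshift k i) < k) by rewrite sk /= -leqNgt leq_addr.
  by case: (split_ordP (s (rshift k i))) => j -> // _; exists j.
pose fa i := xchoose (sL i); pose fb i := xchoose (sR i).
have faE i : s (lshift m i) = lshift m (fa i) := eqP (xchooseP (sL i)).
have fbE i : s (rshift k i) = rshift k (fb i) := eqP (xchooseP (sR i)).
have fa_inj : injective fa.
  move=> i j e; apply: (@lshift_inj k m); apply: (@perm_inj _ s).
  by rewrite !faE e.
have fb_inj : injective fb.
  move=> i j e; apply: (@rshift_inj k m); apply: (@perm_inj _ s).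
  by rewrite !fbE e.
exists (perm fa_inj, perm fb_inj); apply/permP => i.
case: (split_ordP i) => j ->; rewrite (block_permL, block_permR) /= permE.
  exact: faE.
exact: fbE.
Qed.

End BlockPerm.

(** * Permutations fixing one point *)

Section LiftPerm.
Variables (n : nat) (e : 'I_n.+1).

Lemma lift_permP (s : 'S_n.+1) :
  s e = e -> exists t, s = lift_perm e e t.
Proof.
move=> se.
have sL i : exists j, s (lift e i) == lift e j.
  case: (unliftP e (s (lift e i))) => [j -> | ]; first by exists j.
  rewrite -{2}se => /perm_inj/eqP; by rewrite eq_sym (negPf (neq_lift _ _)).
pose f i := xchoose (sL i).
have fE i : s (lift e i) = lift e (f i) := eqP (xchooseP (sL i)).
have f_inj : injective f.
  by move=> i j ef; apply: (@lift_inj _ e); apply: (@perm_inj _ s); rewrite !fE ef.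
exists (perm f_inj); apply/permP => i.
case: (unliftP e i) => [j|] ->; last by rewrite lift_perm_id.
by rewrite lift_perm_lift permE fE.
Qed.

Lemma lift_perm_inj : injective (@lift_perm n e e).
Proof.
move=> s t /permP est; apply/permP => i.
by have := est (lift e i); rewrite !lift_perm_lift => /lift_inj.
Qed.

Lemma sum_lift_perm (V : nmodType) (f : 'S_n.+1 -> V) :
  (\sum_(s : 'S_n.+1 | s e == e) f s = \sum_(t : 'S_n) f (lift_perm e e t))%R.
Proof.
transitivity (\sum_(s in [set lift_perm e e t | t : 'S_n]) f s)%R.
  apply: eq_bigl => s; apply/eqP/imsetP => [/lift_permP[t ->] | [t _ ->]].
    by exists t.
  exact: lift_perm_id.
by rewrite big_imset // => s t _ _; apply: lift_perm_inj.
Qed.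

End LiftPerm.

(** * Splitting at a strong point *)

Section StrongPoints.
Variables (K : comUnitRingType) (q : K).
Local Open Scope ring_scope.

Definition strong_distr : fps K :=
  fun n => \sum_(s : 'S_n) q ^+ #|[set i | strong_point true s i]|.

(** Entries of [b] lie after and above those of [a], so comparing with them imposes no condition. *)
Lemma strong_point_block k m (a : 'S_k) (b : 'S_m) i :
  strong_point true (block_perm (a, b)) (lshift m i) = strong_point true a i.
Proof.
apply/forallP/forallP => /= st j.
  by have := st (lshift m j); rewrite !block_permL.
case: (split_ordP j) => j' ->; rewrite ?block_permL ?block_permR //=.
have := ltn_ord (a i); have := ltn_ord i; lia.
Qed.

Lemma strong_point_blockP k m (s : 'S_(k + m.+1)) :
  strong_point true s (rshift k ord0) <->
  exists a b, s = block_perm (a, lift_perm ord0 ord0 b).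
Proof.
split=> [st | [a [b ->]]].
  have s0 := strong_point_fixed st; have sk i : (s i < k)%N = (i < k)%N.
    by have /forallP/(_ i)/eqP := st; rewrite s0 /= addn0.
  have [[a b] es] := block_permP sk.
  have b0 : b ord0 = ord0.
    by apply: (@rshift_inj k); rewrite -s0 es block_permR.
  by have [t et] := lift_permP b0; exists a, t; rewrite es et.
apply/forallP => j; rewrite block_permR lift_perm_id.
case: (split_ordP j) => j' ->; rewrite ?block_permL ?block_permR /= addn0 ?ltn_ord //.
by rewrite !ltnNge !leq_addr.
Qed.

(** Here [s = a ⊕ 1 ⊕ b] with [a] of size [k]: the strong points before [i] are those of [a], and
    [b] is arbitrary. Equations tie [n] and [i] to [k] and [m], so that any ['I_n] fits without
    casts. *)
Lemma sum_strong_point_before k m n (i : 'I_n) : n = (k + m.+1)%N -> i = k :> nat ->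
  \sum_(s : 'S_n | strong_point true s i)
     q ^+ #|[set j : 'I_n | strong_point true s j & (j < i)%N]|
  = strong_distr k * m`!%:R.
Proof.
move=> en; subst n => ik; have {i ik}-> : i = rshift k ord0.
  by apply: val_inj; rewrite /= addn0.
pose h (ab : 'S_k * 'S_m) := block_perm (ab.1, lift_perm ord0 ord0 ab.2).
have h_inj : injective h.
  by move=> [a b] [a' b'] /block_perm_inj[-> /lift_perm_inj->].
transitivity (\sum_(s in [set h ab | ab : 'S_k * 'S_m])
    q ^+ #|[set j | strong_point true s j & (j < @rshift k m.+1 ord0)%N]|).
  apply: eq_bigl => s; apply/idP/imsetP => [/strong_point_blockP[a [b ->]] | ].
    by exists (a, b).
  by case=> [[a b] _ ->]; apply/strong_point_blockP; exists a, b.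
rewrite big_imset /=; last by move=> ? ? _ _; apply: h_inj.
rewrite -(pair_bigA _ (fun a b => q ^+ #|[set j | strong_point true (h (a, b)) j
   & (j < k + 0)%N]|)) /= mulr_suml.
apply: eq_bigr => a _; rewrite mulr_natr -card_Sn -sumr_const.
apply: eq_big => [b|b _]; first by rewrite inE.
congr (q ^+ _); rewrite -(card_imset _ (@lshift_inj k m.+1)).
apply: eq_card => j; rewrite inE addn0; apply/andP/imsetP => [[]|[i]].
  case: (split_ordP j) => i -> //.
  by rewrite strong_point_block => st _; exists i => //; rewrite inE.
by rewrite inE => st ->; rewrite strong_point_block /= ltn_ord.
Qed.

End StrongPoints.

(** * Recurrence for the distribution of strong points *)

Section StrongSeries.
Variables (K : comUnitRingType) (q : K).
Local Open Scope ring_scope.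

(** The exponents run over [0, ..., #|A| - 1], so this is a geometric sum; the induction is on a
    cutoff [m] for the elements of [A]. *)
Lemma expr_card_telescope n (A : {set 'I_n}) :
  (q - 1) * \sum_(i in A) q ^+ #|[set j in A | (j < i)%N]| = q ^+ #|A| - 1.
Proof.
have before m : (m <= n)%N -> (q - 1) * \sum_(i in A | (i < m)%N)
    q ^+ #|[set j in A | (j < i)%N]| = q ^+ #|[set j in A | (j < m)%N]| - 1.
  elim: m => [|m IHm] lt_mn.
    rewrite big1 => [|i /andP[]//]; rewrite mulr0 (_ : [set _ in A | _] = set0).
      by rewrite cards0 subrr.
    by apply/setP => j; rewrite !inE andbF.
  (* Raising the cutoff adds at most the element [o] of value [m]. *)
  pose o := Ordinal lt_mn; have [oA | oA] := boolP (o \in A); last first.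
    have ltS j : j \in A -> (j < m.+1)%N = (j < m)%N.
      move=> jA; rewrite ltnS leq_eqVlt; case: eqP => // ejm.
      by case/negP: oA; rewrite (_ : o = j) //; apply: val_inj.
    rewrite (eq_bigl (fun i => (i \in A) && (i < m)%N)) => [|i]; last first.
      by have [/ltS -> |] := boolP (i \in A).
    rewrite IHm 1?ltnW //; congr (q ^+ _ - 1); apply: eq_card => j.
    by rewrite !inE; have [/ltS -> |] := boolP (j \in A).
  have -> : [set j in A | (j < m.+1)%N] = o |: [set j in A | (j < m)%N].
    apply/setP => j; rewrite !inE ltnS leq_eqVlt -(inj_eq val_inj) /=.
    by case: eqP => //= ejm; rewrite (_ : j = o) ?oA //; apply: val_inj.
  rewrite cardsU1 inE /= ltnn andbF /= exprD expr1.
  rewrite (bigD1 o) /=; last by rewrite oA ltnSn.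
  rewrite (eq_bigl (fun i => (i \in A) && (i < m)%N)) => [|i]; last first.
    by rewrite -(inj_eq val_inj) /= -andbA [(_ < _.+1)%N && _]andbC -ltn_neqAle.
  rewrite mulrDr IHm 1?ltnW // mulrBl mul1r.
  by rewrite addrA subrK.
have := before n (leqnn n).
rewrite (eq_bigl (mem A)) => [-> | i]; last by rewrite ltn_ord andbT.
by congr (q ^+ _ - 1); apply: eq_card => j; rewrite inE ltn_ord andbT.
Qed.

(** Coefficient form of [D - F = (q - 1) x D F]; [k] is the position of the strong point at which
    the permutation is split. *)
Lemma strong_distr_rec n :
  strong_distr q n = n`!%:R + (q - 1) * \sum_(k < n) strong_distr q k * (n - k.+1)`!%:R.
Proof.
transitivity (\sum_(s : 'S_n) (1 + (q - 1) * \sum_(i | strong_point true s i)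
    q ^+ #|[set j : 'I_n | strong_point true s j & (j < i)%N]|)).
  apply: eq_bigr => s _; have := expr_card_telescope [set i | strong_point true s i].
  rewrite (eq_bigl (strong_point true s)) => [|i]; last by rewrite inE.
  rewrite (eq_bigr (fun i : 'I_n => q ^+ #|[set j : 'I_n | strong_point true s j & (j < i)%N]|)).
    by move=> ->; rewrite addrC subrK.
  by move=> i _; congr (q ^+ _); apply: eq_card => j; rewrite !inE.
rewrite big_split -mulr_sumr sumr_const card_Sn; congr (_ + _ * _).
rewrite (exchange_big_dep predT) //=; apply: eq_bigr => k _.
by apply: sum_strong_point_before; rewrite // subnSK ?subnKC // ltnW.
Qed.

End StrongSeries.

(** * Skew sums and deletion of the forced entry *)

Lemma ltn_lift n (e : 'I_n.+1) (i j : 'I_n) : (lift e i < lift e j) = (i < j).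
Proof. by rewrite /= /bump; case: leqP; case: leqP => ? ?; lia. Qed.

Section Skew.
Variables (K : comUnitRingType) (q : K).
Local Open Scope ring_scope.

(** Products act left to right, so this complements the values of [s], which turns [⊕] into [⊖]. *)
Lemma strong_point_rev n (s : 'S_n) i :
  strong_point false (s * perm (@rev_ord_inj n))%g i = strong_point true s i.
Proof.
apply: eq_forallb => k; rewrite !permM !permE.
have [-> | neq_ki] := eqVneq k i; first by rewrite !ltnn.
have : s k != s i by rewrite (inj_eq perm_inj).
have := ltn_ord (s k); have := ltn_ord (s i); move: neq_ki.
rewrite -!(inj_eq val_inj) /=; lia.
Qed.

Lemma sum_strong_point c n :
  \sum_(s : 'S_n) q ^+ #|[set i | strong_point c s i]| = strong_distr q n.
Proof.
case: c => //; rewrite (reindex_inj (mulIg (perm (@rev_ord_inj n)))) /=.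
apply: eq_bigr => s _; congr (q ^+ _).
by apply: eq_card => i; rewrite !inE strong_point_rev.
Qed.

(* [g] places the free entry of an occurrence, the other entry being the forced
   extreme one at [e]. *)

Lemma sum_mesh12_lift R c n (e : 'I_n.+1) (g : 'I_n.+1 -> 'I_n.+1 * 'I_n.+1) :
  injective g ->
  (forall (s : 'S_n.+1) i j, mesh12_occ R s i j <->
     exists x, [/\ (i, j) = g x, s e = e, x != e &
       forall k, k != e -> (s k < s x)%N = if c then (k < x)%N else (x < k)%N]) ->
  \sum_(s : 'S_n.+1) q ^+ mesh12_count R s
  = n.+1`!%:R - n`!%:R + strong_distr q n.
Proof.
(* Permutations moving [e] have no occurrence and contribute [(n+1)! - n!]; those fixing [e] are the
   lifts of some [t] in ['S_n]. *)
move=> g_inj occP; rewrite (bigID (fun s : 'S_n.+1 => s e == e)) /= addrC.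
congr (_ + _).
  have -> : n.+1`!%:R - n`!%:R = \sum_(s : 'S_n.+1 | s e != e) 1 :> K.
    have cardE m : m`!%:R = \sum_(t : 'S_m) (1 : K) by rewrite sumr_const card_Sn.
    rewrite !cardE -(sum_lift_perm e (fun=> 1 : K)).
    rewrite [X in X - _](bigID (fun s : 'S_n.+1 => s e == e)) /=.
    by rewrite addrAC subrr add0r.
  apply: eq_bigr => s se; rewrite /mesh12_count (_ : [set _ | _] = set0) ?cards0 //.
  apply/setP => -[i j]; rewrite !inE; apply/negbTE/negP => /occP[x [_ /eqP]].
  by rewrite (negPf se).
rewrite sum_lift_perm -(sum_strong_point c); apply: eq_bigr => t _; congr (q ^+ _).
(* Occurrences are the pairs [g (lift e i)] with [i] a strong point of [t] of kind [c]. *)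
have h_inj : injective (g \o lift e) by apply: inj_comp => //; apply: lift_inj.
rewrite /mesh12_count -(card_imset _ h_inj); apply: eq_card => -[i j].
rewrite inE /=; apply/idP/imsetP => [/occP[x [-> _ xe lt_x]] | [x]].
  case: (unliftP e x) xe lt_x => [x' -> _ lt_x | ->]; last by rewrite eqxx.
  exists x' => //; rewrite inE; apply/forallP => k.
  have := lt_x (lift e k); rewrite !lift_perm_lift !ltn_lift => -> //.
  by rewrite eq_sym neq_lift.
rewrite inE => /forallP st eij; apply/occP; exists (lift e x); split => //.
- exact: lift_perm_id.
- by rewrite eq_sym neq_lift.
move=> k; case: (unliftP e k) => [k' -> _ | ->]; last by rewrite eqxx.
by rewrite !lift_perm_lift !ltn_lift (eqP (st k')).
Qed.

End Skew.

(** * Occurrences of the four patterns *)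

Definition strip (a u v w : nat) : bool :=
  match a with 0 => w < u | 1 => u < w < v | _ => v < w end.

(** Listing the boxes as pairs of numbers lets the emptiness conditions compute; [strip] omits the
    outer bounds of the mesh, which ordinals always meet. *)
Lemma mesh12_occE (l : seq (nat * nat)) (R : {set 'I_3 * 'I_3}) n (s : 'S_n) i j :
  all (fun p => (p.1 < 3) && (p.2 < 3)) l ->
  R =i [seq box p.1 p.2 | p <- l] ->
  mesh12_occ R s i j =
    [&& i < j, s i < s j & [forall k : 'I_n, all (fun p =>
      ~~ (strip p.1 i j k && strip p.2 (s i) (s j) (s k))) l]].
Proof.
move=> /allP l3 eR; congr [&& _, _ & _].
have boxE p k : p \in l -> in_box s i j (box p.1 p.2) k
    = strip p.1 i j k && strip p.2 (s i) (s j) (s k).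
  move=> /l3/andP[p1 p2]; rewrite /in_box /= !inordK //.
  case: p p1 p2 => [[|[|[|a]]] [|[|[|b]]]] //= _ _;
    by rewrite ?ltnS ?ltn_ord ?andbT.
apply/forall_inP/forallP => [occ k | occ b].
  apply/allP => p pl; rewrite -boxE //.
  suff /occ/forallP/(_ k) : box p.1 p.2 \in R by [].
  by rewrite eR; apply: (map_f (fun p => box p.1 p.2)).
rewrite eR => /mapP[p pl ->]; apply/forallP => k; rewrite boxE //.
by have /allP/(_ p pl) := occ k.
Qed.

(** By injectivity of [s] only five relative positions of two entries remain; the boolean indices
    let one case analysis rewrite all four comparisons. *)
Variant entry_cmp n (s : 'S_n) (i k : 'I_n) : bool -> bool -> bool -> bool -> Prop :=
  | EntryEq of k = i : entry_cmp s i k false false false false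
  | EntryLL of k < i & s k < s i : entry_cmp s i k true false true false
  | EntryLG of k < i & s i < s k : entry_cmp s i k true false false true
  | EntryGL of i < k & s k < s i : entry_cmp s i k false true true false
  | EntryGG of i < k & s i < s k : entry_cmp s i k false true false true.

Lemma entry_cmpP n (s : 'S_n) (i k : 'I_n) :
  entry_cmp s i k (k < i) (i < k) (s k < s i) (s i < s k).
Proof.
case: (ltngtP k i) => [ki | ik | /val_inj->]; last by rewrite !ltnn; constructor.
- case: (ltngtP (s k) (s i)) => [||/val_inj/perm_inj eki]; try by constructor.
  by rewrite eki ltnn in ki.
- case: (ltngtP (s k) (s i)) => [||/val_inj/perm_inj eki]; try by constructor.
  by rewrite eki ltnn in ik.
Qed.

(* The forced entry [y] of an occurrence is found by testing the empty boxes on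
   the entries at position [e] and of value [e]. *)
Ltac solve_mesh12_occ s i j x y e l :=
  let lt_ij := fresh "lt_ij" in let lt_sij := fresh "lt_sij" in
  let occ := fresh "occ" in let ey := fresh "ey" in let es := fresh "es" in
  let z := fresh "z" in let se := fresh "se" in let ze := fresh "ze" in
  let lt_z := fresh "lt_z" in let eij := fresh "eij" in let ek := fresh "ek" in let k := fresh "k" in
  have := ltn_ord i; have := ltn_ord j; have := ltn_ord (s i); have := ltn_ord (s j);
  rewrite (@mesh12_occE l) //=; last (by move=> ?; rewrite !inE !orbA);
  move=> ? ? ? ?; split;
  [ case/and3P; intros lt_ij lt_sij; move/forallP; intros occ;
    assert (ey : y = e) by (apply: val_inj; move: (occ e);
      case: (entry_cmpP s i e); case: (entry_cmpP s j e) => /= *; subst; lia);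
    assert (es : s e = e) by (apply: val_inj; rewrite -[in LHS]ey;
      move: (congr1 val (permKV s e)); generalize (s^-1 e)%g; intros k ek;
      move: (occ k) ek; case: (entry_cmpP s i k); case: (entry_cmpP s j k);
      move=> /= *; subst; lia);
    exists x; split; rewrite ?ey //;
    [ by apply: contraTneq lt_ij => ->; rewrite ey ltnn
    | intros k; rewrite -(inj_eq val_inj) -ey; move: (occ k) (ltn_ord k) (ltn_ord (s k));
      case: (entry_cmpP s i k); case: (entry_cmpP s j k) => /=;
      intros; subst; lia ]
  (* Conversely, [e] is extreme in position and value, which orders [z] relative to [e] and empties
     the outer row and column; [lt_z] empties the other two boxes. *)
  | intros [z [eij se ze lt_z]]; case: eij => [-> ->];
    move: (ltn_ord z) (ltn_ord (s z)); case: (entry_cmpP s e z) ze (congr1 val se);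
      rewrite -?(inj_eq val_inj) => /= *; (try by subst; lia);
    apply/forallP; intros k;
    move: (lt_z k) (ltn_ord k) (ltn_ord (s k)); rewrite -(inj_eq val_inj);
    case: (entry_cmpP s z k); case: (entry_cmpP s e k) => /= *; subst; lia ].

Section Occurrences.
Variables (n : nat) (s : 'S_n.+1) (i j : 'I_n.+1).

(** The empty right column and top row make [j] last and maximal; [(0,0)] and [(1,1)] give a skew
    sum around [i]. *)
Lemma mesh12_occ_R1 (e : 'I_n.+1) : e = n :> nat -> mesh12_occ R1 s i j <->
  exists x, [/\ (i, j) = (x, e), s e = e, x != e &
    forall k, k != e -> (s k < s x) = (x < k)].
Proof.
move=> en.
solve_mesh12_occ s i j i j e [:: (0,2); (1,2); (2,2); (1,1); (2,1); (0,0); (2,0)].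
Qed.

(** The empty left column and bottom row make [i] first and minimal; [(1,1)] and [(2,2)] give a skew
    sum around [j]. *)
Lemma mesh12_occ_R2 (e : 'I_n.+1) : e = 0 :> nat -> mesh12_occ R2 s i j <->
  exists x, [/\ (i, j) = (e, x), s e = e, x != e &
    forall k, k != e -> (s k < s x) = (x < k)].
Proof.
move=> en.
solve_mesh12_occ s i j j i e [:: (0,2); (2,2); (0,1); (1,1); (0,0); (1,0); (2,0)].
Qed.

(** As for [R1], but [(0,1)] and [(1,0)] give a direct sum around [i]. *)
Lemma mesh12_occ_R3 (e : 'I_n.+1) : e = n :> nat -> mesh12_occ R3 s i j <->
  exists x, [/\ (i, j) = (x, e), s e = e, x != e &
    forall k, k != e -> (s k < s x) = (k < x)].
Proof.
move=> en.
solve_mesh12_occ s i j i j e [:: (0,2); (1,2); (2,2); (0,1); (2,1); (1,0); (2,0)].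
Qed.

(** As for [R2], but [(1,2)] and [(2,1)] give a direct sum around [j]. *)
Lemma mesh12_occ_R4 (e : 'I_n.+1) : e = 0 :> nat -> mesh12_occ R4 s i j <->
  exists x, [/\ (i, j) = (e, x), s e = e, x != e &
    forall k, k != e -> (s k < s x) = (k < x)].
Proof.
move=> en.
solve_mesh12_occ s i j j i e [:: (0,2); (1,2); (0,1); (2,1); (0,0); (1,0); (2,0)].
Qed.

End Occurrences.

(** * Generating functions *)

Section MeshSeries.
Variables (K : comUnitRingType) (q : K).
Local Open Scope ring_scope.

Lemma sum_mesh12_four (R : {set 'I_3 * 'I_3}) n : R \in four_patterns ->
  \sum_(s : 'S_n.+1) q ^+ mesh12_count R s
  = n.+1`!%:R - n`!%:R + strong_distr q n.
Proof.
rewrite !inE => /or4P[] /eqP->.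
- apply: (@sum_mesh12_lift _ _ _ false _ ord_max (fun x => (x, ord_max))) => [? ? []//|s i j].
  exact: mesh12_occ_R1.
- apply: (@sum_mesh12_lift _ _ _ false _ ord0 (fun x => (ord0, x))) => [? ? []//|s i j].
  exact: mesh12_occ_R2.
- apply: (@sum_mesh12_lift _ _ _ true _ ord_max (fun x => (x, ord_max))) => [? ? []//|s i j].
  exact: mesh12_occ_R3.
- apply: (@sum_mesh12_lift _ _ _ true _ ord0 (fun x => (ord0, x))) => [? ? []//|s i j].
  exact: mesh12_occ_R4.
Qed.

(** [G] is [1 + x (1 - q) F], given by its coefficients so that it serves both for a variable [q]
    and for [q = 0]; the recurrence then reads [D G = F]. *)
Lemma strong_distr_mul (G : fps K) :
  G 0%N = 1 -> (forall j, G j.+1 = (1 - q) * j`!%:R) ->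
  (strong_distr q * G)%fps =1 fact_series K.
Proof.
move=> G0 GS n; rewrite /fps_mul big_ord_recr /= subnn G0 mulr1 strong_distr_rec.
rewrite addrCA mulr_sumr -big_split /= big1 ?addr0 // => i _.
by rewrite -subnSK // GS mulrCA -mulrDl addrA subrK subrr mul0r.
Qed.

Lemma mesh12_series (R : {set 'I_3 * 'I_3}) (G : fps K) :
  R \in four_patterns -> G 0%N = 1 -> (forall j, G j.+1 = (1 - q) * j`!%:R) ->
  (fun n => \sum_(s : 'S_n) q ^+ mesh12_count R s)
  =1 ((1 - 'x) * fact_series K + ('x * fact_series K) / G)%fps.
Proof.
move=> R4 G0 GS; have DG := strong_distr_mul G0 GS.
(* The constant term of [G] is [1], so [D G = F] may be divided by [G]. *)
have xFG : ('x * fact_series K / G)%fps =1 ('x * strong_distr q)%fps.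
  move=> n; rewrite -[RHS](@fps_mulK _ _ G) ?G0 ?unitr1 //.
  apply: eq_fps_mul => // m; rewrite -fps_mulA.
  by apply: eq_fps_mul => // k; rewrite DG.
case=> [|n]; rewrite /fps_add xFG fps_mulBl fps_mulCl mul1r.
  rewrite !fps_mulX0 subr0 addr0 (eq_bigr (fun=> 1)) => [|s _].
    by rewrite sumr_const card_Sn.
  rewrite /mesh12_count (_ : [set _ | _] = set0) ?cards0 //.
  by apply/setP => -[[]].
by rewrite !fps_mulXS sum_mesh12_four.
Qed.

End MeshSeries.

Lemma coef_distr_series (R : {set 'I_3 * 'I_3}) n k :
  ((distr_series R n)`_k = (mesh12_s n k R)%:R :> int)%R.
Proof.
rewrite coef_sum -sumr_const [RHS]big_mkcond; apply: eq_bigr => s _.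
by rewrite inE coefXn eq_sym; case: (_ == _).
Qed.

Theorem theorem3p14 :
  (forall R R' : {set 'I_3 * 'I_3},
     R \in four_patterns -> R' \in four_patterns -> equidistributed R R') /\
  (forall R : {set 'I_3 * 'I_3}, R \in four_patterns ->
     (let F : fps int := fact_series int in
      avoid_series R =1
        ((1 - 'x) * F + ('x * F) / (1 + 'x * F))%fps) /\
     (let F : fps {poly int} := fact_series {poly int} in
      distr_series R =1
        ((1 - 'x) * F + ('x * F) / (1 + 'x * (1 - fps_q) * F))%fps)).
Proof.
have distr R : R \in four_patterns -> let F := fact_series {poly int} in
    distr_series R =1
      ((1 - 'x) * F + ('x * F) / (1 + 'x * (1 - fps_q) * F))%fps.
  move=> R4 /=; apply: mesh12_series => // [|j]; rewrite /fps_add -fps_mulA.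
    by rewrite fps_mulX0 addr0.
  by rewrite fps_mulXS add0r fps_mulBl !fps_mulCl mulrBl.
split=> [R R' R4 R'4 n k | R R4]; last (split; last exact: distr).
  (* Both counts are coefficients of series with the same closed form, which does not involve the
     pattern. *)
  by apply/eqP; rewrite -(Num.Theory.eqr_nat int) -!coef_distr_series !distr.
(* Avoidance is the case [q = 0] over [int], since [0 ^ m] is [1] for [m = 0] and [0] otherwise. *)
move=> F n; rewrite -(@mesh12_series _ 0%R R) //.
- rewrite /avoid_series -sumr_const big_mkcond; apply: eq_bigr => s _.
  by rewrite inE expr0n; case: (_ == _).
- by rewrite /fps_add fps_mulX0 addr0.
- by move=> j; rewrite /fps_add fps_mulXS add0r subr0 mul1r.
Qed.
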